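(* There exists an absolute constant $c>0$ such that for every $n>c$ and every $\ell\in\Omega(1)\cap o(\log n/\log\log n)$, there exists an MMDA instance on a layered directed graph $G_\ell$ with $\Theta(n)$ vertices and depth $\ell$ such that the integrality gap of the path hierarchy is still at least $n^{\Omega(1/\ell)}$ after $\ell/c$ rounds.
   Context: MMDA on layered graphs: a layered directed graph $G=(V,E)$ of depth $\ell$ has $V=L_0\dot\cup\cdots\dot\cup L_\ell$, every edge goes from some $L_i$ to $L_{i+1}$, $L_0=\{s\}$ ($s$ the source), vertices of $L_\ell$ are sinks; each non-sink $u$ has a required out-degree $k_u$. For $\alpha\ge1$ an $\alpha$-approximate integral solution is $T\subseteq E$ with $|\delta^+_T(s)|\ge k_s/\alpha$, in-degree at most $1$ in $T$ for every vertex, and $|\delta^+_T(v)|\ge k_v/\alpha$ for every non-sink $v\neq s$ of in-degree $1$ in $T$. Size $n$ = number of vertices. Path hierarchy: add a dummy edge $e_0$ entering $s$. Let $P$ be the set of directed paths (sequences of consecutive edges, possibly starting with $e_0$). For $p\in P$: $C(p)$ is the set of paths of length $|p|+1$ having $p$ as prefix, $D(p)$ the set of paths having $p$ as prefix, $k_p=k_v$ for the last vertex $v$ of $p$; $I(v)$ is the set of paths ending at $v$. Variables $y(p)\in[0,1]$ for $p\in P$, constraints: $\sum_{q\in C(p)}y(q)=k_p\,y(p)$ for all $p$; $\sum_{q\in I(v)\cap D(p)}y(q)\le y(p)$ for all $p,v$; $\sum_{e\in\delta^-(v)}y(\{e\})\le1$ for all $v$; $\sum_{e\in\delta^+(v)}y(\{e\})\ge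 k_v\sum_{e\in\delta^-(v)}y(\{e\})$ for all $v$; $y(q)\le y(p)$ whenever $p\subseteq q$; $y(\{e_0\})=1$. The $t$-th level ($t$ rounds) keeps only the constraints involving no path of length more than $t+1$. The integrality gap of a relaxation is $\alpha_{\mathrm{int}}/\alpha_R$, where $\alpha_{\mathrm{int}}$ is the least $\alpha$ with an $\alpha$-approximate integral solution and $\alpha_R$ the least $\alpha$ for which the relaxation is feasible with each $k_u$ replaced by $k_u/\alpha$. *)

(* Defs.v *)
From HB Require Import structures.
From mathcomp Require Import all_boot all_order all_algebra.
From mathcomp Require Import all_classical all_reals all_analysis.
Import Order.TTheory GRing.Theory Num.Theory.
Local Open Scope ring_scope.

Record instance := Instance {
  nv : nat;
  layer : 'I_nv -> nat;
  arc : rel 'I_nv;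
  src : 'I_nv;
  kreq : 'I_nv -> nat }.

Set Implicit Arguments. Unset Strict Implicit. Unset Printing Implicit Defensive.

Definition layered (I : instance) (ell : nat) : Prop :=
  [/\ (forall u v, arc I u v -> layer I v = (layer I u).+1),
      (forall v, (layer I v <= ell)%N),
      (forall v, layer I v = 0%N <-> v = src I) &
      (forall i, (i <= ell)%N -> exists v, layer I v = i)].

Section Defs.
Variable I : instance.

Definition is_sink (ell : nat) (v : 'I_(nv I)) : bool := layer I v == ell.
Definition kk (ell : nat) (v : 'I_(nv I)) : nat :=
  if is_sink ell v then 0%N else kreq I v.

(* Edges, plus the dummy edge e0 = (None, s) entering s. *)
Definition edge := (option 'I_(nv I) * 'I_(nv I))%type.
Definition e0 : edge := (None, src I).
Definition valid (e : edge) : bool :=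
  match e with
  | (None, v) => v == src I
  | (Some u, v) => arc I u v
  end.

Definition is_path (p : seq edge) : bool :=
  [&& p != [::], all valid p & sorted (fun e f : edge => f.1 == Some e.2) p].
Definition lastv (p : seq edge) : 'I_(nv I) := (last e0 p).2.
Definition ext (p : seq edge) (e : edge) : bool :=
  valid e && (e.1 == Some (lastv p)).

(* enumeration of all paths (of length at most nv+1, which bounds the length
   of every path in a layered graph, counting e0) *)
Fixpoint seqs_of (T : finType) (m : nat) : seq (seq T) :=
  if m is m'.+1 then [seq e :: s | e <- enum T, s <- seqs_of T m'] else [:: [::]].
Definition all_paths : seq (seq edge) :=
  undup [seq p <- flatten [seq seqs_of edge m | m <- iota 1 (nv I).+1] | is_path p].

Definition DI (p : seq edge) (v : 'I_(nv I)) : seq (seq edge) :=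
  [seq q <- all_paths | prefix p q & lastv q == v].

Variable R : realType.

(* t-th level of the path hierarchy, with every k_u replaced by k_u / alpha:
   only constraints involving no path of length more than t+1 are kept. *)
Definition hier_feasible (ell t : nat) (alpha : R) : Prop :=
  let k v := (kk ell v)%:R / alpha in
  exists y : seq edge -> R,
  [/\ (forall p, is_path p -> 0 <= y p <= 1),
      (forall p, is_path p -> (size p <= t.+1)%N ->
         (forall e, ext p e -> ((size p).+1 <= t.+1)%N) ->
         \sum_(e : edge | ext p e) y (rcons p e) = k (lastv p) * y p),
      (forall p v, is_path p -> (size p <= t.+1)%N ->
         all (fun q => size q <= t.+1)%N (DI p v) ->
         \sum_(q <- DI p v) y q <= y p) &
   [/\
      (forall v, \sum_(e : edge | valid e && (e.2 == v)) y [:: e] <= 1),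
      (forall v, \sum_(e : edge | valid e && (e.1 == Some v)) y [:: e] >=
                 k v * \sum_(e : edge | valid e && (e.2 == v)) y [:: e]),
      (forall p q, is_path p -> is_path q -> {subset p <= q} ->
         (size q <= t.+1)%N -> y q <= y p) &
      y [:: e0] = 1]].

Definition indegT (T : {set 'I_(nv I) * 'I_(nv I)}) v := #|[set e in T | e.2 == v]|.
Definition outdegT (T : {set 'I_(nv I) * 'I_(nv I)}) v := #|[set e in T | e.1 == v]|.

Definition integral_sol (ell : nat) (alpha : R) : Prop :=
  exists T : {set 'I_(nv I) * 'I_(nv I)},
  [/\ (forall e, e \in T -> arc I e.1 e.2),
      (outdegT T (src I))%:R >= (kk ell (src I))%:R / alpha,
      (forall v, (indegT T v <= 1)%N) &
      (forall v, ~~ is_sink ell v -> v != src I -> indegT T v = 1%N ->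
         (outdegT T v)%:R >= (kk ell v)%:R / alpha)].

(* The integrality gap alpha_int / alpha_R of the t-th level is at least g,
   where alpha_int (resp. alpha_R) is the least alpha >= 1 admitting an
   alpha-approximate integral solution (resp. making the relaxation feasible). *)
Definition gap_at_least (ell t : nat) (g : R) : Prop :=
  exists aR : R, 1 <= aR /\ hier_feasible ell t aR /\
    forall a : R, 1 <= a -> integral_sol ell a -> g * aR <= a.

End Defs.

(* Main.v *)
(* The gap instance is a layered butterfly.  Below the source s every layer
   consists of the words of length L = ell - 1 over k letters, s (with
   requirement 1) points to all of the first layer, and a step out of the i-th
   of these layers may rewrite the letter i mod t only; all other requirements
   are k.

   A local flow sees nothing wrong: give every edge below s the value
   k ^ (i - 1) / k ^ L, where i is the layer of its tail, and let a longer path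
   have the value of its first edge, so that conditionally on a path all arcs
   leaving its end are taken with value 1.  Two vertices are joined by at most
   one walk of length at most t, so no constraint of the t-th level notices
   that this conditional flow overloads the sinks.

   Integrally, the letters at positions at least t never change, so a vertex of
   the first layer reaches only k ^ t sinks, while an a-approximate solution
   has to reach (k / a) ^ L of them.  As 2 t <= L, this forces k <= a ^ 2. *)
Require Import Defs.
From HB Require Import structures.
From mathcomp Require Import all_boot all_order all_algebra.
From mathcomp Require Import all_classical all_reals all_analysis.
From mathcomp Require Import zify ring lra.
Import Order.TTheory GRing.Theory Num.Theory.
Local Open Scope ring_scope.

Set Implicit Arguments.
Unset Strict Implicit.
Unset Printing Implicit Defensive.

Local Notation path := path.path.
Local Notation arc := Defs.arc.

(** * Paths as edge sequences, walks as vertex sequences, and sums over edges *)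

Section Paths.
Variable I : instance.
Implicit Types (u v : 'I_(nv I)) (e : edge I) (p q r : seq (edge I)).

Definition consec : rel (edge I) := fun e f => f.1 == Some e.2.

Lemma is_path_cons e r :
  is_path (e :: r) = [&& valid e, all (@valid I) r & path consec e r].
Proof. by rewrite /is_path /= andbA. Qed.

Lemma walk_of_path e r : all (@valid I) r -> path consec e r ->
  path (arc I) e.2 [seq f.2 | f <- r].
Proof.
elim: r e => [//|[[u|] v] r IH] e //= /andP[va vr] /andP[/eqP uE pr].
by case: uE => <-; rewrite va (IH (Some u, v)).
Qed.

(** Each tail is the head of the preceding edge, so after a fixed first edge the heads determine the
    path. This lets uniqueness of walks be used for paths. *)
Lemma path_of_walk_inj e r1 r2 : path consec e r1 -> path consec e r2 ->
  [seq f.2 | f <- r1] = [seq f.2 | f <- r2] -> r1 = r2.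
Proof.
elim: r1 r2 e => [|[a v] r1 IH] [|[b w] r2] e //= /andP[/eqP /= -> p1].
move=> /andP[/eqP /= -> p2] [vE rE]; rewrite -vE in p2 *.
by congr cons; exact: (IH _ _ p1 p2).
Qed.

Lemma sum_edges_from (V : nmodType) (F : edge I -> V) u :
  \sum_(e : edge I | valid e && (e.1 == Some u)) F e =
  \sum_(v | arc I u v) F (Some u, v).
Proof.
rewrite (reindex_onto (fun v => (Some u, v)) snd) /=.
  by apply: eq_bigl => v; rewrite /= !eqxx !andbT.
by case=> a v /= /andP[_ /eqP ->].
Qed.

(** The source is excluded because the dummy edge also enters it. *)
Lemma sum_edges_to (V : nmodType) (F : edge I -> V) v : v != src I ->
  \sum_(e : edge I | valid e && (e.2 == v)) F e =
  \sum_(u | arc I u v) F (Some u, v).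
Proof.
move=> vs; rewrite (reindex_onto (fun u => (Some u, v)) (fun e => odflt v e.1)) /=.
  by apply: eq_bigl => u; rewrite /= !eqxx !andbT.
case=> [[u|] w] /= /andP[va /eqP wv]; first by rewrite wv.
by move: va vs; rewrite wv => ->.
Qed.

End Paths.

(** * Feasibility of the relaxation when short walks are determined by their ends *)

Section Relaxation.
Variables (R : realType) (I : instance) (ell t k : nat).
Implicit Types (u v w : 'I_(nv I)) (e f : edge I) (p q r : seq (edge I)).
Hypothesis layI : layered I ell.
Hypothesis k_gt0 : (0 < k)%N.
Hypothesis outdeg_src : #|[set v | arc I (src I) v]| = (k ^ ell.-1)%N.
Hypothesis kk_src : kk ell (src I) = 1%N.
Hypothesis outdeg : forall v, v != src I -> #|[set w | arc I v w]| = kk ell v.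
Hypothesis inflow : forall v, v != src I ->
  (\sum_(u | arc I u v) k ^ (layer I u).-1 <= k ^ (layer I v).-1)%N.
Hypothesis walk_inj : forall w (p1 p2 : seq 'I_(nv I)), w != src I ->
  path (arc I) w p1 -> path (arc I) w p2 -> last w p1 = last w p2 ->
  (size p1 <= t)%N -> (size p2 <= t)%N -> p1 = p2.

Let K : R := (k ^ ell.-1)%:R.

(** The default case serves the paths that continue beyond [e0]. They get [K^-1], which is also the
    value of an edge leaving the source, since the truncated predecessor of layer 0 is 0. *)
Definition weight (p : seq (edge I)) : R :=
  match p with
  | [:: (None, _)] => 1
  | (Some u, _) :: _ => (k ^ (layer I u).-1)%:R / K
  | _ => K^-1
  end.

Let K_gt0 : 0 < K. Proof. by rewrite ltr0n expn_gt0 k_gt0. Qed.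
Let K_neq0 : K != 0. Proof. by rewrite gt_eqF. Qed.
Let K_ge1 : 1 <= K. Proof. by rewrite ler1n expn_gt0 k_gt0. Qed.

Let layer_src : layer I (src I) = 0%N.
Proof. by case: layI => _ _ h _; apply/h. Qed.

Let arc_src u : arc I u (src I) = false.
Proof. by apply/negP; case: layI => h _ _ _ /h; rewrite layer_src. Qed.

Let arc_layer u v : arc I u v -> layer I v = (layer I u).+1.
Proof. by case: layI => h _ _ _ /h. Qed.

Let arc_neq_src u v : arc I u v -> v != src I.
Proof. by apply: contraTneq => ->; rewrite arc_src. Qed.

Lemma power_layer_le u : (k ^ (layer I u).-1)%:R / K <= 1.
Proof.
rewrite ler_pdivrMr // mul1r ler_nat leq_pexp2l //.
by case: layI => _ h _ _; have := h u; case: (layer I u) ell => [|a] [|b].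
Qed.

Lemma power_layer_ge u : K^-1 <= (k ^ (layer I u).-1)%:R / K.
Proof. by rewrite ler_pMl ?invr_gt0 // ler1n expn_gt0 k_gt0. Qed.

Lemma weight_bounds p : K^-1 <= weight p <= 1.
Proof.
have i1 : K^-1 <= 1 by rewrite invf_le1.
case: p => [|[[u|] v] [|f p]] /=; rewrite ?lexx ?i1 //;
  by rewrite power_layer_le power_layer_ge.
Qed.

Lemma weight_ge0 p : 0 <= weight p.
Proof.
by case/andP: (weight_bounds p) => h _; apply: le_trans h; rewrite invr_ge0 ltW.
Qed.

(** Only at [[:: e0 I]] does an extension alter the weight, from 1 to [K^-1]. *)
Lemma weight_rcons p e : is_path p -> p != [:: e0 I] ->
  weight (rcons p e) = weight p.
Proof.
case: p => [|[[u|] v] [|f p]] //=.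
by rewrite is_path_cons /= andbT => /eqP ->; rewrite eqxx.
Qed.

Lemma weight_cat p q : is_path p -> p != [:: e0 I] -> weight (p ++ q) = weight p.
Proof.
case: p => [|[[u|] v] [|f p]] //=.
by rewrite is_path_cons /= andbT => /eqP ->; rewrite eqxx.
Qed.

(** No arc enters the source, which has layer 0; only the dummy edge ends there, and it can only
    come first in a path. *)
Lemma path_lastv_neq_src p : is_path p -> p != [:: e0 I] -> lastv p != src I.
Proof.
case: p => [//|e p]; rewrite is_path_cons => /and3P[ve vp pp] pe.
rewrite /lastv /=; case: (lastP p) vp pp pe => [_ _|r f].
  by case: e ve => [[u|] v] /= => [/arc_neq_src|/eqP ->]; rewrite ?eqxx.
rewrite last_rcons all_rcons rcons_path => /andP[vf _] /andP[_].
by case: f vf => [[u|] v] //= /arc_neq_src.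
Qed.

(** The [K] extensions of [e0] share its unit value equally. At any other path the extensions keep
    the weight, and their number is exactly the requirement. *)
Lemma weight_children p : is_path p ->
  \sum_(e : edge I | ext p e) weight (rcons p e) = (kk ell (lastv p))%:R * weight p.
Proof.
move=> pp; have [->|pe] := eqVneq p [:: e0 I].
  rewrite /lastv /= kk_src mulr1 /ext /lastv /= sum_edges_from /=.
  by rewrite sumr_const -cardsE outdeg_src -[RHS](mulVf K_neq0) mulr_natr.
under eq_bigr do rewrite weight_rcons //.
rewrite sum_edges_from sumr_const -cardsE outdeg ?path_lastv_neq_src //.
by rewrite mulr_natl.
Qed.

Lemma inflow_weight v : v != src I ->
  \sum_(e : edge I | valid e && (e.2 == v)) weight [:: e] <=
  (k ^ (layer I v).-1)%:R / K.
Proof.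
move=> vs; rewrite sum_edges_to //= -mulr_suml ler_pM2r ?invr_gt0 //.
by rewrite -natr_sum ler_nat inflow.
Qed.

Lemma inflow_src :
  \sum_(e : edge I | valid e && (e.2 == src I)) weight [:: e] = 1.
Proof.
rewrite (big_pred1 (e0 I)) // => -[[u|] v] /=; rewrite /e0 xpair_eqE /=.
  by apply/negP => /andP[/[swap] /eqP ->]; rewrite arc_src.
by rewrite andbb.
Qed.

Lemma DI_uniq p v : uniq (DI p v).
Proof. exact/filter_uniq/undup_uniq. Qed.

Lemma DIP p v q : q \in DI p v -> [/\ is_path q, prefix p q & lastv q = v].
Proof.
by rewrite mem_filter mem_undup mem_filter => /and3P[/andP[? /eqP ?] ? _].
Qed.

(** Both continuations are walks from the head of [f], so [walk_inj] applies. *)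
Lemma same_ends p f r1 r2 : f.2 != src I ->
  is_path (rcons p f ++ r1) -> is_path (rcons p f ++ r2) ->
  lastv (rcons p f ++ r1) = lastv (rcons p f ++ r2) ->
  (size r1 <= t)%N -> (size r2 <= t)%N -> r1 = r2.
Proof.
have dec r : is_path (rcons p f ++ r) -> all (@valid I) r && path (@consec I) f r.
  case: p => [|e p]; rewrite /= is_path_cons; first by case/and3P=> _ -> ->.
  by rewrite all_cat cat_path last_rcons => /and3P[_ /andP[_ ->] /andP[_ ->]].
have lst r : lastv (rcons p f ++ r) = last f.2 [seq g.2 | g <- r].
  by rewrite /lastv last_cat last_rcons last_map.
move=> fs /dec/andP[v1 p1] /dec/andP[v2 p2]; rewrite !lst => ll s1 s2.
apply: (path_of_walk_inj p1 p2); apply: (walk_inj fs) => //;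
  by rewrite ?size_map //; apply: walk_of_path.
Qed.

(** Beyond [e0], a path has at most one descendant ending at [v], of the same weight. Below [e0],
    the descendants ending at [v] leave the source by distinct arcs, so there are at most [K] of
    them, each of weight [K^-1]. *)
Lemma weight_descendants p v : is_path p ->
  all (fun q => size q <= t.+1)%N (DI p v) ->
  \sum_(q <- DI p v) weight q <= weight p.
Proof.
move=> pp /allP sz; have [pe|pe] := eqVneq p [:: e0 I]; last first.
  have sz1 : (size (DI p v) <= 1)%N.
    case: p pp pe sz => [//|e p] pp pe sz.
    case: (lastP (e :: p)) pp pe sz => [//|r f] pp pe sz.
    have fs : f.2 != src I by have := path_lastv_neq_src pp pe; rewrite /lastv last_rcons.
    have sub q : q \in DI (rcons r f) v ->
        exists2 s, q = rcons r f ++ s & (size s <= t)%N.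
      move=> qD; have [_ /prefixP[s qE] _] := DIP qD; exists s => //.
      have := sz _ qD; rewrite qE size_cat size_rcons addSn ltnS.
      by apply: leq_trans; rewrite leq_addl.
    have := DI_uniq (rcons r f) v; have := sub.
    case DE: (DI (rcons r f) v) => [//|q1 [//|q2 D]] {}sub /=.
    have q1D : q1 \in DI (rcons r f) v by rewrite DE mem_head.
    have q2D : q2 \in DI (rcons r f) v by rewrite DE !inE eqxx orbT.
    rewrite -DE in sub.
    have [s1 e1 z1] := sub _ q1D; have [s2 e2 z2] := sub _ q2D.
    have [h1 _ l1] := DIP q1D; have [h2 _ l2] := DIP q2D.
    rewrite inE; suff -> : q1 = q2 by rewrite eqxx.
    rewrite e1 e2; congr (_ ++ _); apply: (@same_ends r f) => //.
    - by rewrite -e1. - by rewrite -e2. - by rewrite -e1 -e2 l1.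
  rewrite big_seq (eq_bigr (fun=> weight p)); last first.
    by move=> q /DIP[_ /prefixP[s ->] _]; rewrite weight_cat.
  rewrite -big_seq big_const_seq count_predT iter_addr_0.
  by case: (size _) sz1 => [|[|]] // _; rewrite ?mulr0n ?weight_ge0 ?mulr1n.
rewrite {p pp}pe /= in sz *.
have [vs|vs] := eqVneq v (src I).
  have DE q : q \in DI [:: e0 I] v -> q = [:: e0 I].
    move=> /DIP[qp _ qv]; apply/eqP; apply: contraTT isT => qe.
    by have := path_lastv_neq_src qp qe; rewrite qv vs eqxx.
  have := DI_uniq [:: e0 I] v; case: (DI _ _) DE => [|q1 [|q2 D]] DE.
  - by rewrite big_nil.
  - by rewrite big_seq1 (DE q1) ?mem_head.
  have e1 := DE q1 (mem_head _ _).
  have e2 : q2 = [:: e0 I] by apply: DE; rewrite !inE eqxx orbT.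
  by rewrite e1 e2 /= inE eqxx.
have dec q : q \in DI [:: e0 I] v ->
    exists f r, [/\ q = rcons [:: e0 I] f ++ r, f = (Some (src I), f.2),
                    arc I (src I) f.2 & (size r <= t)%N].
  move=> qD; have [qp /prefixP[[|f r] qE] qv] := DIP qD.
    by move: qv vs; rewrite qE => <-; rewrite eqxx.
  exists f, r; move: qp; rewrite qE /= is_path_cons.
  move=> /and3P[_ /andP[vf _] /andP[/eqP /= fE _]].
  case: f vf fE qE => [a w] /= + aE; rewrite aE /= => auw qE; split=> //.
  by have := sz _ qD; rewrite qE /= ltnS => /ltnW.
(* Index 1 is the edge after [e0]: [h] reads off the out-neighbour of the source through which the
   path goes. *)
pose h q := (nth (e0 I) q 1).2.
have hinj : {in DI [:: e0 I] v &, injective h}.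
  move=> q1 q2 D1 D2; have [h1 _ l1] := DIP D1; have [h2 _ l2] := DIP D2.
  have [f1 [r1 [E1 f1E a1 s1]]] := dec _ D1; have [f2 [r2 [E2 f2E a2 s2]]] := dec _ D2.
  rewrite /h E1 E2 /= => fE.
  have ff : f1 = f2 by rewrite f1E f2E fE.
  rewrite -{f2 f2E fE a2}ff in E2 *.
  congr [:: _, _ & _]; apply: (@same_ends [:: e0 I] f1) => //.
  - exact: arc_neq_src a1. - by rewrite -E1. - by rewrite -E2. - by rewrite -E1 -E2 l1.
rewrite big_seq (eq_bigr (fun=> K^-1)); last first.
  by move=> q /dec[f [r [-> _ _ _]]].
rewrite -big_seq big_const_seq count_predT iter_addr_0.
rewrite -mulr_natl ler_pdivrMr // mul1r ler_nat.
rewrite -outdeg_src cardE -(size_map h); apply: uniq_leq_size.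
  by rewrite map_inj_in_uniq // DI_uniq.
move=> _ /mapP[q /dec[f [r [-> _ a _]]] ->].
by rewrite mem_enum inE.
Qed.

Lemma layer_tail_ge e r f : is_path (e :: r) -> f \in e :: r ->
  f = e \/ exists2 u, f.1 = Some u & (layer I e.2 <= layer I u)%N.
Proof.
elim: r e => [|g r IH] e; rewrite is_path_cons.
  by move=> _; rewrite inE => /eqP; left.
move=> /= /and3P[_ /andP[vg vr] /andP[/eqP ge pr]].
rewrite inE => /predU1P[->|fr]; [by left | right].
have gp : is_path (g :: r) by rewrite is_path_cons vg vr.
case: (IH g gp fr) => [->|[u fu le]]; first by exists e.2.
exists u => //; apply: leq_trans le.
by case: g ge vg {gp pr IH fr} => [a w] /= -> /arc_layer ->.
Qed.

(** When [q] starts at a vertex [u], all its tails have at least the layer of [u], among them the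
    first tail of [p]; weights of first edges grow with the layer. *)
Lemma weight_sub p q : is_path p -> is_path q -> {subset p <= q} ->
  weight q <= weight p.
Proof.
case: q => [|[[u|] w] q] pp qp sub.
- by case: p pp sub => [//|f p] _ /(_ f (mem_head _ _)).
- case: p pp sub => [//|f p] pp sub.
  have fq := sub _ (mem_head _ _).
  have auw : arc I u w by move: qp; rewrite is_path_cons => /and3P[].
  have [u' fu le] : exists2 u', f.1 = Some u' & (layer I u <= layer I u')%N.
    case: (layer_tail_ge qp fq) => [->|[u' fu le]]; first by exists u.
    by exists u' => //; apply: leq_trans le; rewrite /= (arc_layer auw).
  case: f fu {pp sub fq} => [_ w'] /= ->.
  rewrite ler_pM2r ?invr_gt0 // ler_nat leq_pexp2l //.
  by rewrite -!subn1 leq_sub2r.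
(* A path continuing beyond [e0] has the least possible weight. If [q] is [e0] alone, so is [p],
   since two dummy edges are never consecutive. *)
case: q qp sub => [|g q] qp sub; last by case/andP: (weight_bounds p).
case: p pp sub => [//|f [|g p]] pp sub.
  by have := sub f (mem_head _ _); rewrite inE => /eqP ->.
move: pp; rewrite is_path_cons => /and3P[_ _ /= /andP[]].
have := sub g; rewrite !inE eqxx orbT => /(_ isT) /eqP ->.
by rewrite /consec.
Qed.

Lemma relaxation_feasible : hier_feasible I ell t (1 : R).
Proof.
exists weight; split.
- move=> p pp; rewrite weight_ge0; by case/andP: (weight_bounds p).
- by move=> p pp _ _; rewrite weight_children // divr1.
- by move=> p v pp _ sz; apply: weight_descendants.
split=> //.
- move=> v; have [->|vs] := eqVneq v (src I); first by rewrite inflow_src.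
  exact: le_trans (inflow_weight vs) (power_layer_le v).
- move=> v; rewrite divr1 sum_edges_from /= sumr_const -cardsE.
  have [->|vs] := eqVneq v (src I).
    rewrite inflow_src kk_src mulr1 outdeg_src layer_src /= expn0 mul1r.
    by rewrite -[leRHS]mulr_natl mulfV.
  rewrite outdeg // mulrC mulr_natr ler_wMn2r //; exact: inflow_weight.
by move=> p q pp qp pq _; apply: weight_sub.
Qed.

End Relaxation.

(** * Growth of integral solutions inside a set closed under arcs *)

(** In-degree at most 1 gives the chosen edges distinct heads, so the number of vertices of [S]
    reached by [T] grows by a factor [k / a] at each of the [ell.-1] layers below the first. *)
Lemma integral_sol_growth (R : realType) (I : instance) (ell k M : nat) (a : R) :
  layered I ell -> (0 < ell)%N -> (0 < kk ell (src I))%N -> 1 <= a ->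
  (forall w, arc I (src I) w -> exists S : {set 'I_(nv I)},
    [/\ w \in S,
        forall u v, u \in S -> arc I u v -> v \in S,
        forall v, v \in S -> (0 < layer I v < ell)%N -> kk ell v = k &
        (#|[set v in S | layer I v == ell]| <= M)%N]) ->
  integral_sol I ell a -> (k%:R / a) ^+ ell.-1 <= M%:R.
Proof.
move=> [arcL _ srcL _] ell0 ks a1 hS [T [Tarc Tsrc Tin Tout]].
have a0 : 0 < a by apply: lt_le_trans a1.
have r0 : 0 <= k%:R / a by rewrite divr_ge0 ?ler0n ?ltW.
(* However large [a] is, a positive requirement forces at least one edge out of the source. *)
have : (0 < outdegT T (src I))%N.
  by rewrite -(ltr0n R) (lt_le_trans _ Tsrc) // divr_gt0 // ltr0n.
rewrite card_gt0 => /set0Pn[[u w]]; rewrite inE => /andP[Tw /eqP /= uE].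
have sw := Tarc _ Tw; rewrite {u}uE /= in Tw sw.
have [S [wS Scl Sk Scard]] := hS _ sw.
have indeg1 e : e \in T -> indegT T e.2 == 1%N.
  move=> Te; rewrite eqn_leq Tin card_gt0; apply/set0Pn; exists e.
  by rewrite inE Te eqxx.
have inj2 : {in T &, injective snd}.
  move=> e f Te Tf ef; have /card_le1_eqP := Tin e.2; apply;
    by rewrite inE ?Te ?Tf ?ef eqxx.
pose A i := [set v in S | (layer I v == i) && (indegT T v == 1%N)].
have step i : (0 < i < ell)%N -> k%:R / a * #|A i|%:R <= #|A i.+1|%:R.
  move=> il; rewrite mulr_natr -sumr_const.
  apply: (@le_trans _ _ (\sum_(v in A i) (outdegT T v)%:R)).
    apply: ler_sum => v; rewrite inE => /and3P[vS /eqP vi /eqP v1].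
    rewrite -(Sk v) ?vi //; apply: Tout => //.
      by rewrite /is_sink vi neq_ltn; case/andP: il => _ ->.
    by apply: contraTneq il => /srcL; rewrite vi => ->.
  rewrite -natr_sum ler_nat /outdegT.
  have -> : (\sum_(v in A i) #|[set e in T | e.1 == v]| =
             #|[set e in T | e.1 \in A i]|)%N.
    rewrite -[RHS]sum1_card (partition_big fst (mem (A i))) /=; last first.
      by move=> e; rewrite inE => /andP[].
    apply: eq_bigr => v vA; rewrite -sum1_card; apply: eq_bigl => e.
    rewrite !inE -andbA; case: (e.1 =P v) => [->|]; rewrite ?andbT ?andbF //.
    by move: vA; rewrite inE => ->; rewrite andbT.
  rewrite -(card_in_imset (f := snd)); last first.
    by move=> e f; rewrite !inE => /andP[Te _] /andP[Tf _]; apply: inj2.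
  apply/subset_leq_card/fintype.subsetP => _ /imsetP[e + ->].
  rewrite !inE => /and4P[Te eS /eqP ei _].
  by rewrite (Scl _ _ eS (Tarc _ Te)) (arcL _ _ (Tarc _ Te)) ei eqxx indeg1.
have grow i : (i < ell)%N -> (k%:R / a) ^+ i <= #|A i.+1|%:R.
  elim: i => [_|i IH il].
    rewrite expr0 ler1n card_gt0; apply/set0Pn; exists w.
    rewrite inE wS (arcL _ _ sw) (_ : layer I (src I) = 0%N) ?eqxx /=.
      exact: (indeg1 (src I, w)).
    exact/srcL.
  rewrite exprS; apply: le_trans (step i.+1 _) => //.
  by rewrite ler_wpM2l // IH // ltnW.
have := grow ell.-1; rewrite prednK // => /(_ (leqnn _)) /le_trans; apply.
rewrite ler_nat; apply: leq_trans Scard; apply/subset_leq_card/fintype.subsetP => v.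
by rewrite !inE => /and3P[-> -> _].
Qed.

(** * The butterfly graph: degrees and uniqueness of short walks *)

Section Butterfly.
Variables (L t k n : nat).
Hypothesis t_gt0 : (0 < t)%N.
Hypothesis t_le : (t <= L)%N.
Hypothesis k_gt0 : (0 < k)%N.
Local Open Scope nat_scope.

Local Notation word := {ffun 'I_L -> 'I_k}.

(* [None] is the source, [Some (inl (i, f))] sits in layer [i.+1], and the
   [Some (inr _)] are isolated sinks that bring the number of vertices to
   order [n]. *)
Definition bvertex := option ('I_L.+1 * word + 'I_n)%type.

Definition agree_off (r : nat) (f g : word) :=
  [forall x : 'I_L, (x != r :> nat) ==> (f x == g x)].

Definition barc : rel bvertex := fun u v =>
  match u, v with
  | None, Some (inl (i, _)) => i == ord0
  | Some (inl (i, f)), Some (inl (j, g)) => (j == i.+1 :> nat) && agree_off (i %% t) f g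
  | _, _ => false
  end.

Definition blayer (v : bvertex) : nat :=
  match v with
  | None => 0
  | Some (inl (i, _)) => i.+1
  | Some (inr _) => L.+1
  end.

Definition breq (v : bvertex) : nat := if v is None then 1 else k.

Definition butterfly : instance :=
  @Instance #|{: bvertex}| (fun v => blayer (enum_val v))
    (fun u v => barc (enum_val u) (enum_val v)) (enum_rank None)
    (fun v => breq (enum_val v)).

Lemma nv_butterfly : nv butterfly = (L.+1 * k ^ L + n).+1.
Proof. by rewrite /= card_option card_sum card_prod card_ffun !card_ord. Qed.

Implicit Types (f g : word) (u v w : bvertex).

Lemma agree_offP r f g :
  reflect (forall x : 'I_L, x != r :> nat -> f x = g x) (agree_off r f g).
Proof.
apply: (iffP forallP) => h x; first by move=> xr; apply/eqP; have /implyP -> := h x.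
by apply/implyP => /h ->.
Qed.

Lemma agree_off_sym r f g : agree_off r f g = agree_off r g f.
Proof. by apply/agree_offP/agree_offP => h x /h. Qed.

Lemma card_agree_off r f : r < L -> #|[set g | agree_off r f g]| = k.
Proof.
move=> rL.
pose upd (c : 'I_k) : word := [ffun x : 'I_L => if x == r :> nat then c else f x].
have -> : [set g | agree_off r f g] = upd @: [set: 'I_k].
  apply/setP => g; rewrite inE; apply/agree_offP/imsetP => [h|[c _ ->] x xr].
    exists (g (Ordinal rL)) => //; apply/ffunP => x; rewrite ffunE.
    by case: eqP => [xr|/eqP /h //]; congr (g _); apply: val_inj.
  by rewrite ffunE (negbTE xr).
rewrite card_imset ?cardsT ?card_ord // => c d /ffunP/(_ (Ordinal rL)).
by rewrite !ffunE eqxx.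
Qed.

Lemma barc_layer u v : barc u v -> blayer v = (blayer u).+1.
Proof.
by case: u v => [[[i f]|?]|] [[[j g]|?]|] //= => [/andP[/eqP -> _]|/eqP ->].
Qed.

Lemma card_barc_src : #|[set v | barc None v]| = k ^ L.
Proof.
have -> : [set v | barc None v] = (fun f => Some (inl (ord0, f))) @: [set: word].
  apply/setP => v; rewrite inE; apply/idP/imsetP => [|[f _ ->]]; last exact: eqxx.
  by case: v => [[[j g]|?]|] //= /eqP ->; exists g; rewrite ?inE.
by rewrite card_imset ?cardsT ?card_ffun ?card_ord // => f g [].
Qed.

Lemma card_barc_from (i : 'I_L.+1) f : i < L ->
  #|[set v | barc (Some (inl (i, f))) v]| = k.
Proof.
move=> iL; have rL : i %% t < L by apply: leq_trans t_le; rewrite ltn_mod.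
have iL' : i.+1 < L.+1 by [].
have -> : [set v | barc (Some (inl (i, f))) v] =
    (fun g => Some (inl (Ordinal iL', g))) @: [set g | agree_off (i %% t) f g].
  apply/setP => v; rewrite inE; apply/idP/imsetP => [|[g + ->]]; last first.
    by rewrite inE /= eqxx.
  case: v => [[[j g]|?]|] //= /andP[/eqP ji fg]; exists g; rewrite ?inE //.
  by congr (Some (inl (_, _))); apply: val_inj.
by rewrite card_imset ?card_agree_off // => g h [].
Qed.

(** Only the source precedes the first layer. Further down, [agree_off] is symmetric, so
    predecessors are counted like successors. *)
Lemma card_barc_to (j : 'I_L.+1) g :
  #|[set u | barc u (Some (inl (j, g)))]| <= if j == ord0 then 1 else k.
Proof.
case: eqVneq => [->|j0].
  rewrite -(cards1 (None : bvertex)); apply/subset_leq_card/fintype.subsetP => u.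
  by rewrite !inE; case: u => [[[i f]|?]|].
have jL : j.-1 < L by rewrite prednK ?lt0n // -ltnS ltn_ord.
have rL : j.-1 %% t < L by apply: leq_trans t_le; rewrite ltn_mod.
rewrite -[leqRHS](card_agree_off g rL).
pose up (f : word) : bvertex := Some (inl (inord j.-1, f)).
rewrite -(card_imset (f := up)); last by move=> ? ? [].
apply/subset_leq_card/fintype.subsetP => u; rewrite inE => uj; apply/imsetP.
case: u uj => [[[i f]|?]|] //= => [/andP[/eqP ji fg]|]; last by rewrite (negbTE j0).
exists f; first by rewrite inE agree_off_sym ji.
by congr (Some (inl (_, _))); apply: val_inj; rewrite /= inordK; [rewrite ji|exact: ltnW].

Qed.

(** The layer of the end reveals the length of the walk, and a letter survives when no step visits
    its position. *)
Lemma bwalk_last (i : 'I_L.+1) f p : path barc (Some (inl (i, f))) p ->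
  exists j : 'I_L.+1, exists g : word,
    [/\ last (Some (inl (i, f))) p = Some (inl (j, g)), j = i + size p :> nat &
        forall x : 'I_L, (forall s, s < size p -> (i + s) %% t != x) -> g x = f x].
Proof.
elim: p i f => [|v p IH] i f /=; first by exists i, f; rewrite addn0.
case: v => [[[i' f']|?]|] //= /andP[/andP[/eqP ii /agree_offP ff] /IH[j [g [-> jE gf]]]].
exists j, g; split=> //; first by rewrite jE ii addSnnS.
move=> x hx; rewrite gf; first by rewrite ff // eq_sym -[nat_of_ord i]addn0 hx.
by move=> s sp; rewrite ii addSnnS hx.
Qed.

(* A step out of layer [i] rewrites the letter [i %% t], which the next
   [t - 1] steps leave alone; hence the end of a walk of length at most [t]
   determines its first step. *)
Lemma bwalk_inj w p1 p2 : w != None -> path barc w p1 -> path barc w p2 ->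
  last w p1 = last w p2 -> size p1 <= t -> size p2 <= t -> p1 = p2.
Proof.
case: w => [[[i f]|z]|] // _; last first.
  by case: p1 p2 => [|? ?] [|? ?].
elim: p1 p2 i f => [|v1 p1 IH] p2 i f w1 w2 ll s1 s2.
  (* With one walk empty, the layer of the common end forces the other to be empty too. *)
  have [j [g [e jE _]]] := bwalk_last w2; rewrite -ll /= in e.
  by case: e jE => <- _ /eqP; rewrite -[X in X == _]addn0 eqn_add2l; case: (p2).
case: p2 w2 ll s2 => [|v2 p2] w2 ll s2.
  have [j [g [e jE _]]] := bwalk_last w1; rewrite ll /= in e.
  by case: e jE => <- _ /eqP; rewrite -[X in X == _]addn0 eqn_add2l.
rewrite /= in s1 s2.
case: v1 w1 ll => [[[i1 f1]|?]|] //= /andP[/andP[/eqP i1E /agree_offP f1E] w1].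
case: v2 w2 => [[[i2 f2]|?]|] //= /andP[/andP[/eqP i2E /agree_offP f2E] w2] ll.
have ii : i1 = i2 by apply: val_inj; rewrite /= i1E i2E.
rewrite -{i2 i2E}ii in w2 ll *.
suff ff : f1 = f2.
  by rewrite -ff in w2 ll *; congr cons; apply: (IH _ i1 f1) => //; exact: ltnW.
have [j [g [e _ gf1]]] := bwalk_last w1.
have [j' [g' [e' _ gf2]]] := bwalk_last w2.
have gg : g = g' by move: ll; rewrite e e' => -[].
apply/ffunP => x; have [xi|xi] := eqVneq (x : nat) (i %% t); last by rewrite -f1E // f2E.
have fresh s : s < t.-1 -> (i1 + s) %% t != x.
  move=> st; rewrite xi i1E addSnnS -[X in _ != X %% _]addn0 eqn_modDl mod0n.
  by rewrite modn_small // -ltn_predRL.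
rewrite -gf1 -?gf2 ?gg // => s sp; apply: fresh; rewrite ltn_predRL;
  by [apply: leq_ltn_trans s1|apply: leq_ltn_trans s2].
Qed.


(** * The butterfly as an [instance], with vertices renamed as ordinals through [enum_val] *)

Lemma card_enum_val (T : finType) (P : pred T) :
  #|[set i : 'I_#|{: T}| | P (enum_val i)]| = #|[set v | P v]|.
Proof.
rewrite -(on_card_preimset (f := @enum_val T T)); last exact/onW_bij/enum_val_bij.
by apply: eq_card => i; rewrite !inE.
Qed.

Lemma outdeg_butterfly (v : 'I_(nv butterfly)) :
  #|[set w | arc butterfly v w]| = #|[set y | barc (enum_val v) y]|.
Proof. exact: (card_enum_val (barc (enum_val v))). Qed.

Lemma indeg_butterfly (v : 'I_(nv butterfly)) :
  #|[set u | arc butterfly u v]| = #|[set x | barc x (enum_val v)]|.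
Proof. exact: (card_enum_val (fun x => barc x (enum_val v))). Qed.

Lemma enum_val_neq_src (v : 'I_(nv butterfly)) :
  (v != src butterfly) = (enum_val v != None).
Proof.
by rewrite /= -(inj_eq (can_inj (@enum_valK bvertex))) enum_rankK.
Qed.

Lemma butterfly_layered : layered butterfly L.+1.
Proof.
split=> [u v|v|v|i iL] /=.
- exact: barc_layer.
- by case: (enum_val v) => [[[i f]|?]|] //=; exact: ltn_ord.
- split=> [|->]; last by rewrite enum_rankK.
  by move: (enum_valK v); case: (enum_val v) => [[[i f]|?]|] /= <-.
case: i iL => [|i] iL; first by exists (enum_rank None); rewrite enum_rankK.
by exists (enum_rank (Some (inl (Ordinal iL, [ffun=> Ordinal k_gt0]))));
  rewrite enum_rankK.
Qed.

Lemma butterfly_feasible (R : realType) : hier_feasible butterfly L.+1 t (1 : R).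
Proof.
apply: (@relaxation_feasible R butterfly L.+1 t k butterfly_layered k_gt0).
- by rewrite outdeg_butterfly enum_rankK card_barc_src.
- by rewrite /kk /is_sink /= enum_rankK.
- move=> v; rewrite enum_val_neq_src outdeg_butterfly /kk /is_sink /=.
  case: (enum_val v) => [[[i f]|z]|] //= _; last first.
    by rewrite eqxx; apply: eq_card0 => w; rewrite inE.
  rewrite eqSS; case: eqVneq => [iL|iL].
    apply: eq_card0 => -[[[j g]|z]|]; rewrite inE //=.
    by rewrite iL; apply/negbTE; rewrite negb_and neq_ltn ltn_ord.
  by rewrite card_barc_from // ltn_neqAle iL -ltnS ltn_ord.
- move=> v; rewrite enum_val_neq_src => vs.
  (* All in-neighbours lie one layer up, so the terms are equal. In the first layer truncation makes
     the exponent 0, matching the source. *)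
  rewrite (eq_bigr (fun=> k ^ (layer butterfly v).-2)); last first.
    by move=> u /barc_layer /= ->.
  rewrite sum_nat_const -cardsE indeg_butterfly /=.
  case: (enum_val v) vs => [[[j g]|z]|] //= _; last first.
    by rewrite (eq_card0 (A := [set _ | _])) // => -[[[? ?]|?]|]; rewrite inE.
  apply: leq_trans (leq_mul (card_barc_to j g) (leqnn _)) _.
  case: eqVneq => [->|]; first by rewrite mul1n.
  by rewrite -lt0n => j0; rewrite -expnS prednK.
move=> w p1 p2; rewrite enum_val_neq_src => ws w1 w2 ll s1 s2.
apply: (inj_map (can_inj (@enum_valK bvertex))).
apply: (bwalk_inj ws); rewrite ?size_map ?last_map ?ll //; by rewrite path_map.
Qed.

Lemma butterfly_integral (R : realType) (a : R) : (1 <= a)%R ->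
  integral_sol butterfly L.+1 a -> ((k%:R / a) ^+ L <= (k ^ t)%:R)%R.
Proof.
move=> a1; apply: (integral_sol_growth butterfly_layered) => //.
  by rewrite /kk /is_sink /= enum_rankK.
move=> w; rewrite /= enum_rankK.
case ew: (enum_val w) => [[[i f]|z]|] //= _.
(* Steps rewrite positions below [t] only, so sharing all later letters with [f] is preserved by
   arcs. *)
pose inS (v : bvertex) := if v is Some (inl (_, g)) then
  [forall x : 'I_L, (t <= x) ==> (g x == f x)] else false.
exists [set v | inS (enum_val v)]; split.
- by rewrite inE ew /=; apply/forallP => x; rewrite eqxx implybT.
- move=> u v; rewrite !inE.
  case: (enum_val u) (enum_val v) => [[[i1 g1]|?]|] [[[i2 g2]|?]|] //=.
  move=> /forallP h /andP[_ /agree_offP gg]; apply/forallP => x.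
  apply/implyP => tx; rewrite -gg; first by have /implyP -> := h x.
  by rewrite neq_ltn orbC (leq_trans _ tx) // ltn_mod.
- move=> v; rewrite inE /kk /is_sink /= => vS /andP[_ vL].
  by rewrite (ltn_eqF vL); case: (enum_val v) vS.
set A := [set v in _ | _].
(* [h] overwrites the first [t] letters of [f]; its image contains all sinks of the set, which
   bounds them by [k ^ t]. *)
pose h (b : {ffun 'I_t -> 'I_k}) : bvertex :=
  Some (inl (ord_max, [ffun x : 'I_L => oapp b (f x) (insub (val x))])).
have -> : k ^ t = #|[set: {ffun 'I_t -> 'I_k}]| by rewrite cardsT card_ffun !card_ord.
rewrite -(card_imset A enum_val_inj).
apply: leq_trans (leq_imset_card h _); apply/subset_leq_card/fintype.subsetP.
move=> _ /imsetP[v + ->]; rewrite !inE /=.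
case: (enum_val v) => [[[j g]|?]|] //= /andP[/forallP gS /eqP[jL]].
apply/imsetP; exists [ffun y => g (widen_ord t_le y)]; rewrite ?inE //.
congr (Some (inl (_, _))); first exact: val_inj.
apply/ffunP => x; rewrite ffunE; case: insubP => [y xt yx|] /=.
  by rewrite ffunE; congr (g _); apply: val_inj.
by rewrite -leqNgt => tx; have /implyP/(_ tx)/eqP := gS x.
Qed.

End Butterfly.

(** * Numerical estimates and the choice of parameters *)

(** Squaring gives [(k / a) ^ (2 L) <= k ^ (2 t) <= k ^ L]; an [L]-th root leaves
    [(k / a) ^ 2 <= k]. *)
Lemma ratio_bound (R : realType) (k L t : nat) (a : R) :
  (0 < k)%N -> 1 <= a -> (0 < L)%N -> (t.*2 <= L)%N ->
  (k%:R / a) ^+ L <= (k ^ t)%:R -> k%:R <= a ^+ 2.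
Proof.
move=> k0 a1 L0 tL h; have a0 : 0 < a by apply: lt_le_trans a1.
have ka0 : 0 <= k%:R / a by rewrite divr_ge0 ?ler0n ?ltW.
have : ((k%:R / a) ^+ 2) ^+ L <= k%:R ^+ L.
  rewrite -exprM mulnC exprM.
  apply: (@le_trans _ _ ((k ^ t)%:R ^+ 2)).
    by rewrite ler_pXn2r ?nnegrE ?exprn_ge0.
  by rewrite -!natrX ler_nat -expnM muln2 leq_pexp2l.
rewrite ler_pXn2r ?nnegrE ?exprn_ge0 // expr_div_n ler_pdivrMr ?exprn_gt0 //.
by rewrite expr2 ler_pM2l ?ltr0n.
Qed.

Lemma powR_root_expn (R : realType) (x : R) (m : nat) : 0 <= x -> (0 < m)%N ->
  (x `^ m%:R^-1) ^+ m = x.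
Proof.
move=> x0 m0; rewrite -powR_mulrn ?powR_ge0 // -powRrM mulVf ?powRr1 //.
by rewrite pnatr_eq0 -lt0n.
Qed.

Lemma exists_degree (R : realType) (n ell : nat) (z : R) : (0 < ell)%N ->
  2 <= z -> z ^+ (4 * ell) = n%:R ->
  exists k : nat, z <= k%:R /\ (ell * k ^ ell.-1 <= n)%N.
Proof.
move=> ell0 z2 zn; have z0 : 0 <= z by lra.
have z1 : 1 <= z by lra.
have /andP[kle klt] : (Num.truncn (z ^+ 2))%:R <= z ^+ 2 < (Num.truncn (z ^+ 2)).+1%:R.
  by apply: truncn_itv; rewrite exprn_ge0.
(* The truncation exceeds [z ^ 2 - 1], which is at least [z] because [z >= 2]. For the size,
   [ell <= 2 ^ ell <= z ^ ell] and [k ^ (ell - 1) <= z ^ (3 ell)]. *)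
exists (Num.truncn (z ^+ 2)); split.
  by rewrite -natr1 in klt; nra.
rewrite -(ler_nat R) natrM natrX -zn (_ : 4 * ell = ell + (ell + 2 * ell))%N; last by lia.
rewrite exprD ler_pM ?exprn_ge0 //.
  apply: (@le_trans _ _ (2 ^+ ell)); last by rewrite ler_pXn2r ?nnegrE.
  by rewrite -natrX ler_nat ltnW // ltn_expl.
apply: (@le_trans _ _ (z ^+ (2 * ell.-1))).
  by rewrite exprM lerXn2r ?nnegrE ?exprn_ge0.
by apply: ler_weXn2l => //; lia.
Qed.

Theorem theorem2 (R : realType) :
  exists c : nat, (0 < c)%N /\
  exists C1 C2 d : R, [/\ 0 < C1, 0 < C2 & 0 < d] /\
  forall ell : nat -> nat,
    (* ell \in Omega(1): eventually at least the absolute constant c *)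
    (exists n1, forall n, (n1 <= n)%N -> (c <= ell n)%N) ->
    (* ell \in o(log n / log log n) *)
    (forall eps : R, 0 < eps -> exists n1, forall n, (n1 <= n)%N ->
        (ell n)%:R * ln (ln n%:R) <= eps * ln n%:R) ->
    exists n0, forall n : nat, (c < n)%N -> (n0 <= n)%N ->
      exists G : instance,
        [/\ layered G (ell n),
            C1 * n%:R <= (nv G)%:R <= C2 * n%:R &
            gap_at_least G (ell n) (ell n %/ c) ((n%:R) `^ (d / (ell n)%:R))].
Proof.
(* With [ell >= 4], [t = ell %/ 4] satisfies [1 <= t] and [2 t <= ell - 1]. The vertices number
   [ell * k ^ (ell - 1) + n + 1], between [n] and [3 n]. The exponent 1/8 is half of the 1/4 in [z],
   because [z <= k <= a ^ 2]. *)
exists 4%N; split=> //; exists 1, 3, 8^-1; split; first by split.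
(* Once [ln (ln n) >= 1], the choice 1/4 yields [4 ell <= ln n], so that [z] is at least [expR 1],
   hence at least 2. The threshold [expR (expR 1)] on [n] secures the former. *)
move=> ell [n1 ell_ge] /(_ 4^-1 _)[//|n2 ell_le].
exists (maxn (maxn n1 n2) (Num.truncn (expR (expR 1) : R)).+1) => n n4.
rewrite !geq_max -andbA => /and3P[/ell_ge l4 /ell_le lle nbig].
have n_gt0 : 0 < n%:R :> R by rewrite ltr0n; lia.
have l_gt0 : 0 < (ell n)%:R :> R by rewrite ltr0n; lia.
have lnln : 1 <= ln (ln (n%:R : R)).
  have e1 : expR (expR 1) <= n%:R :> R.
    by rewrite ltW // (lt_le_trans (truncnS_gt _)) // ler_nat.
  have e2 : expR 1 <= ln (n%:R : R) by rewrite -[leLHS]expRK ler_ln ?posrE ?expR_gt0.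
  by rewrite -[leLHS]expRK ler_ln ?posrE ?expR_gt0 // (lt_le_trans _ e2) ?expR_gt0.
pose z : R := n%:R `^ (4 * ell n)%:R^-1.
have z2 : 2 <= z.
  rewrite /z /powR gt_eqF //; apply: (@le_trans _ _ (expR 1)).
    by have := expR_ge1Dx (1 : R); lra.
  rewrite ler_expR mulrC ler_pdivlMr ?mul1r ?natrM; last by rewrite mulr_gt0.
  have : (ell n)%:R <= (ell n)%:R * ln (ln (n%:R : R)) by rewrite ler_peMr ?(ltW l_gt0).
  lra.
have zn : z ^+ (4 * ell n) = n%:R by rewrite powR_root_expn ?(ltW n_gt0) //; lia.
have [|k [zk kn]] := exists_degree _ z2 zn; first by lia.
have k_gt0 : (0 < k)%N by rewrite -(ltr0n R) (lt_le_trans _ zk) //; lra.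
have LE : (ell n).-1.+1 = ell n by lia.
have t_gt0 : (0 < ell n %/ 4)%N by lia.
have t_le : (ell n %/ 4 <= (ell n).-1)%N by lia.
exists (butterfly (ell n).-1 (ell n %/ 4) k n); split.
- by have := butterfly_layered (ell n).-1 (ell n %/ 4) n k_gt0; rewrite LE.
- rewrite nv_butterfly LE mul1r -natrM !ler_nat; lia.
exists 1; split=> //; split.
  by have := butterfly_feasible n t_gt0 t_le k_gt0 R; rewrite LE.
move=> a a1 sol; rewrite mulr1.
have ka : k%:R <= a ^+ 2.
  apply: (@ratio_bound _ _ (ell n).-1 (ell n %/ 4)) => //; try lia.
  by apply: (@butterfly_integral _ _ _ n) => //; rewrite LE.
have wz : (n%:R `^ (8^-1 / (ell n)%:R)) ^+ 2 = z.
  rewrite -powR_mulrn ?powR_ge0 // -powRrM /z natrM; congr (_ `^ _).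
  by field; rewrite gt_eqF.
rewrite -(@ler_pXn2r _ 2) ?nnegrE ?powR_ge0 //; last by lra.
by rewrite wz (le_trans zk).
Qed.
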